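(* There is a universal constant $C$ such that for all integers $n,d\ge1$ and every real $c$ with $0<c\le nd(2+\log_2(7/4))$ there exists an independent protocol $\pi$ with $n$ clients such that $\mathcal{C}(\pi,S^d)\le c$ and $$\mathcal{E}(\pi,S^d)\;\le\; C\min\left(1,\frac dc\right).$$
   Context: Distributed mean estimation: $n$ clients hold vectors $X^n=(X_1,\dots,X_n)$, $X_i\in\mathbb{R}^d$, with mean $\bar X=\frac1n\sum_{i=1}^nX_i$. $S^d=\{x\in\mathbb{R}^d:\|x\|_2\le1\}$. An independent (simultaneous) protocol $\pi$: each client $i$ sends to a server one binary string that is a function of $X_i$, its own private randomness and public randomness (a random variable shared by all clients and the server); private randomness is independent across clients and independent of the public randomness. Messages are self-delimiting: given the public randomness, the set of possible messages of each client is prefix-free (it may consist only of the empty string, in which case the client sends $0$ bits). The server outputs an estimate $\hat{\bar X}\in\mathbb{R}^d$ as a function of the $n$ messages and the randomness available to it. $\mathcal{C}(\pi,X^n)$ is the expected total number of bits sent by all clients on input $X^n$, and $\mathcal{C}(\pi,S^d)=\sup\{\mathcal{C}(\pi,X^n):X_i\in S^d\ \forall i\}$. $\mathcal{E}(\pi,X^n)=\mathbb{E}\|\hat{\bar X}-\bar X\|_2^2$ and $\mathcal{E}(\pi,S^d)=\sup\{\mathcal{E}(\pi,X^n):X_i\in S^d\ \forall i\}$. Expectations are over the randomness of the protocol. *)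

(* Defs.v *)
From HB Require Import structures.
From mathcomp Require Export all_boot all_order all_algebra.
From mathcomp Require Export all_classical all_reals all_analysis.

Set Implicit Arguments.
Unset Strict Implicit.
Unset Printing Implicit Defensive.

Import Order.TTheory GRing.Theory Num.Theory.

Local Open Scope classical_set_scope.
Local Open Scope ring_scope.

(* The library norm on row vectors is the sup norm, hence this definition. *)
Definition l2norm {R : realType} {d : nat} (x : 'rV[R]_d) : R :=
  Num.sqrt (\sum_(j < d) x 0 j ^+ 2).

Definition unit_ball (R : realType) (d : nat) : set 'rV[R]_d :=
  [set x | l2norm x <= 1].
Arguments unit_ball R d : clear implicits.

Definition mean {R : realType} {n d : nat} (X : 'I_n -> 'rV[R]_d) : 'rV[R]_d :=
  n%:R^-1 *: \sum_(i < n) X i.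

Definition log2 {R : realType} (x : R) : R := ln x / ln 2.

Definition prefix_free (M : set (seq bool)) : Prop :=
  forall s t, M s -> M t -> prefix s t -> s = t.

(* Mutual independence of the family U, W_0, ..., W_(n-1); taking some of the
   test sets equal to setT gives the product rule for every subfamily. *)
Definition mutually_independent {R : realType} {n : nat}
    {d0 d1 : measure_display} {d2 : 'I_n -> measure_display}
    {Omega : measurableType d0} (P : probability Omega R)
    {T : measurableType d1} {S : forall i, measurableType (d2 i)}
    (U : {RV P >-> T}) (W : forall i, {RV P >-> S i}) : Prop :=
  forall (A : set T) (B : forall i, set (S i)),
    measurable A -> (forall i, measurable (B i)) ->
    P [set w | A (U w) /\ forall i, B i (W i w)] =
    (P (U @^-1` A) * \prod_(i < n) P (W i @^-1` B i))%E.

(* An independent (simultaneous) protocol with n clients for vectors of R^d.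
   The inputs are deterministic, so measurability is required only with respect
   to the randomness; as there are countably many message tuples, the conditions
   below make the number of bits sent and the estimate random variables. *)
Record protocol (R : realType) (n d : nat) := Protocol {
  omega_display : measure_display;
  omega : measurableType omega_display;
  prob : probability omega R;
  public_display : measure_display;
  public_type : measurableType public_display;
  public : {RV prob >-> public_type};
  private_display : 'I_n -> measure_display;
  private_type : forall i, measurableType (private_display i);
  private : forall i, {RV prob >-> private_type i};
  encode : forall i, public_type -> private_type i -> 'rV[R]_d -> seq bool;
  decode : public_type -> ('I_n -> seq bool) -> 'rV[R]_d;
  randomness_independent : mutually_independent public private;
  encode_measurable : forall i (x : 'rV[R]_d) (s : seq bool),
    measurable [set p : public_type * private_type i | encode p.1 p.2 x = s];
  decode_measurable : forall (m : 'I_n -> seq bool) (j : 'I_d),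
    measurable_fun setT (fun u => decode u m 0 j);
  encode_prefix_free : forall i (u : public_type),
    prefix_free [set s | exists (v : private_type i) (x : 'rV[R]_d),
                           encode u v x = s]
}.

Section protocol_performance.
Context {R : realType} {n d : nat} (pi : protocol R n d).
Implicit Type X : 'I_n -> 'rV[R]_d.

Definition message X (w : omega pi) (i : 'I_n) : seq bool :=
  encode (public pi w) (private pi i w) (X i).

Definition estimate X (w : omega pi) : 'rV[R]_d :=
  decode (public pi w) (message X w).

Definition cost X : \bar R :=
  expectation (prob pi) (fun w => \sum_(i < n) (size (message X w i))%:R).

Definition error X : \bar R :=
  expectation (prob pi) (fun w => l2norm (estimate X w - mean X) ^+ 2).

Definition worst_cost (S : set 'rV[R]_d) : \bar R :=
  ereal_sup [set cost X | X in [set X | forall i, S (X i)]].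

Definition worst_error (S : set 'rV[R]_d) : \bar R :=
  ereal_sup [set error X | X in [set X | forall i, S (X i)]].

End protocol_performance.

(* Main.v *)
(* Put s = sqrt d and q = floor (4 n d / c) + 1, so that q is of order n d / c.
   Each client transmits with probability 1 / q. A transmitting client rounds
   every s x_j to a neighbouring integer k_j by a shared-coin dither, which is
   unbiased up to 1 / n, and sends each k_j as a sign followed by |k_j| in
   unary. As |s x| <= s, this costs at most 4 d bits, hence at most
   4 n d / q <= c on average. The server averages the vectors q k / s, each of
   second moment at most 4 q; by independence across clients the error is at
   most 4 q / n plus the squared bias 1 / n ^ 2, which is O(d / c). When
   c <= d, sending nothing and estimating 0 has error at most 1. *)
From HB Require Import structures.
From mathcomp Require Import zify ring lra.
Require Import Defs.

Set Implicit Arguments.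
Unset Strict Implicit.
Unset Printing Implicit Defensive.

Import Order.TTheory GRing.Theory Num.Theory.
Local Open Scope classical_set_scope.
Local Open Scope ring_scope.

(** * The uniform distribution on an initial segment of the naturals *)

Section UniformNat.
Context {R : realType} (m : nat).

(** Having [m.+1] atoms keeps the normalisation away from division by 0. Every subset of [nat] is
    measurable, so this sample space raises no measurability problem. *)
Definition uniform_nat : set nat -> \bar R :=
  mscale (m.+1%:R^-1)%:nng (msum (fun k => \d_k) m.+1).

HB.instance Definition _ := Measure.on uniform_nat.

Lemma uniform_nat_setT : uniform_nat [set: nat] = 1%E.
Proof.
rewrite /uniform_nat /mscale /=.
have -> : msum (fun k : nat => \d_k) m.+1 [set: nat] = (m.+1%:R : R)%:E.
  rewrite /msum (eq_bigr (fun=> 1%:E)) => [|k _]; last exact: diracT.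
  by rewrite sumEFin sumr_const card_ord.
by rewrite -EFinM mulVf.
Qed.

HB.instance Definition _ :=
  Measure_isProbability.Build _ _ R uniform_nat uniform_nat_setT.

Lemma expectation_uniform_nat (f : nat -> R) : (forall k, 0 <= f k) ->
  expectation uniform_nat f = (m.+1%:R^-1 * \sum_(k < m.+1) f k)%:E.
Proof.
move=> f0; rewrite expectation.unlock.
rewrite ge0_integral_mscale//=; last by move=> x _; rewrite lee_fin.
rewrite ge0_integral_measure_sum//=; last by move=> x _; rewrite lee_fin.
rewrite EFinM -sumEFin; congr (_ * _)%E; apply: eq_bigr => k _.
by rewrite integral_dirac//= diracT mul1e.
Qed.

End UniformNat.

(** * Averages over finite types: independence and the bias-variance decomposition *)

Definition average {R : realType} {T : finType} (f : T -> R) : R :=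
  #|T|%:R^-1 * \sum_t f t.

Section Average.
Context {R : realType}.

Lemma eq_average {T : finType} (f g : T -> R) :
  f =1 g -> average f = average g.
Proof. by move=> fg; rewrite /average (eq_bigr _ (fun t _ => fg t)). Qed.

Lemma le_average {T : finType} (f g : T -> R) :
  (forall t, f t <= g t) -> average f <= average g.
Proof. by move=> fg; rewrite ler_wpM2l ?invr_ge0 ?ler0n ?ler_sum. Qed.

(** The point [t0] excludes the empty type, over which every average is 0. *)
Lemma average_cst {T : finType} (t0 : T) (a : R) :
  average (fun _ : T => a) = a.
Proof.
rewrite /average sumr_const -[a *+ _]mulr_natl mulrA mulVf ?mul1r //.
by rewrite pnatr_eq0 -lt0n; apply/card_gt0P; exists t0.
Qed.

Lemma averageD {T : finType} (f g : T -> R) :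
  average (fun t => f t + g t) = average f + average g.
Proof. by rewrite /average big_split mulrDr. Qed.

Lemma averageZ {T : finType} (a : R) (f : T -> R) :
  average (fun t => a * f t) = a * average f.
Proof. by rewrite /average -mulr_sumr mulrCA. Qed.

Lemma average_sum {T : finType} (I : finType) (f : I -> T -> R) :
  average (fun t => \sum_i f i t) = \sum_i average (f i).
Proof. by rewrite /average exchange_big mulr_sumr. Qed.

Lemma average_pair {T1 T2 : finType} (f : T1 -> R) (g : T2 -> R) :
  average (fun p : T1 * T2 => f p.1 * g p.2) = average f * average g.
Proof.
rewrite /average card_prod natrM invfM mulrACA; congr (_ * _).
rewrite mulr_suml -(pair_bigA _ (fun i j => f i * g j)) /=.
by apply: eq_bigr => i _; rewrite mulr_sumr.
Qed.

(** Independence of the coordinates of a uniform random function: expanding a product of sums gives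
    one term per function. The marginal laws below follow by setting the other factors to 1. *)
Lemma average_prod {I T : finType} (g : I -> T -> R) :
  average (fun f : {ffun I -> T} => \prod_i g i (f i)) = \prod_i average (g i).
Proof.
rewrite /average big_split /= card_ffun prodr_const natrX exprVn.
by congr (_ * _); rewrite bigA_distr_bigA.
Qed.

Lemma average_ffun1 {I T : finType} (t0 : T) (i : I) (g : T -> R) :
  average (fun f : {ffun I -> T} => g (f i)) = average g.
Proof.
pose G (l : I) (t : T) : R := if l == i then g t else 1.
have prodG (f : {ffun I -> T}) : \prod_l G l (f l) = g (f i).
  by rewrite (bigD1 i) //= big1 ?mulr1 /G ?eqxx // => l /negPf ->.
rewrite -(eq_average prodG) average_prod (bigD1 i) //= big1 ?mulr1.
  by apply: eq_average => t; rewrite /G eqxx.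
move=> l /negPf li; rewrite -[RHS](average_cst t0).
by apply: eq_average => t; rewrite /G li.
Qed.

Lemma average_ffun2 {I T : finType} (t0 : T) (i k : I) (g h : T -> R) :
  i != k ->
  average (fun f : {ffun I -> T} => g (f i) * h (f k)) = average g * average h.
Proof.
move=> ik; have ki : (k == i) = false by rewrite eq_sym (negPf ik).
pose G (l : I) (t : T) : R := if l == i then g t else if l == k then h t else 1.
have prodG (f : {ffun I -> T}) : \prod_l G l (f l) = g (f i) * h (f k).
  rewrite (bigD1 i) //= (bigD1 k) /= ?ki // big1 ?mulr1 /G ?eqxx ?ki //.
  by move=> l /andP[/negPf -> /negPf ->].
rewrite -(eq_average prodG) average_prod (bigD1 i) //= (bigD1 k) ?ki //= big1.
  rewrite mulr1; congr (_ * _); apply: eq_average => t; rewrite /G ?ki eqxx //.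
move=> l /andP[/negPf li /negPf lk]; rewrite -[RHS](average_cst t0).
by apply: eq_average => t; rewrite /G li lk.
Qed.

(** Variances of independent variables add: each off-diagonal term factors into two averages equal
    to 0. *)
Lemma average_sqr_centered_sum {I T : finType} (t0 : T) (h : I -> T -> R) :
  (forall i, average (h i) = 0) ->
  average (fun f : {ffun I -> T} => (\sum_i h i (f i)) ^+ 2) =
  \sum_i average (fun t => h i t ^+ 2).
Proof.
move=> h0.
transitivity (average (fun f : {ffun I -> T} =>
    \sum_i \sum_k h i (f i) * h k (f k))).
  by apply: eq_average => f; rewrite expr2 mulr_suml;
     apply: eq_bigr => i _; rewrite mulr_sumr.
rewrite average_sum; apply: eq_bigr => i _.
rewrite average_sum (bigD1 i) //= big1 ?addr0.
  by rewrite -(average_ffun1 t0 i); apply: eq_average => f; rewrite expr2.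
by move=> k ki; rewrite average_ffun2 // 1?eq_sym // h0 mul0r.
Qed.

Lemma average_sqr_centered {T : finType} (t0 : T) (g : T -> R) :
  average (fun t => (g t - average g) ^+ 2) =
  average (fun t => g t ^+ 2) - average g ^+ 2.
Proof.
set m := average g.
transitivity (average (fun t => g t ^+ 2 + (- (2 * m) * g t + m ^+ 2))).
  by apply: eq_average => t; ring.
by rewrite averageD averageD averageZ (average_cst t0) -/m; ring.
Qed.

Lemma sqr_average_le {T : finType} (t0 : T) (g : T -> R) :
  average g ^+ 2 <= average (fun t => g t ^+ 2).
Proof.
rewrite -subr_ge0 -(average_sqr_centered t0) mulr_ge0 ?invr_ge0 ?ler0n //.
by apply: sumr_ge0 => t _; exact: sqr_ge0.
Qed.

(* Bias-variance decomposition, the variance being bounded by the second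
   moment. *)
Lemma average_sqr_sum_le {I T : finType} (t0 : T) (g : I -> T -> R) (x : I -> R) :
  average (fun f : {ffun I -> T} => (\sum_i g i (f i) - \sum_i x i) ^+ 2) <=
  \sum_i average (fun t => g i t ^+ 2) + (\sum_i (average (g i) - x i)) ^+ 2.
Proof.
pose h i t := g i t - average (g i).
pose b := \sum_i (average (g i) - x i).
have h0 i : average (h i) = 0.
  by rewrite averageD (average_cst t0) subrr.
have sum_h0 : average (fun f : {ffun I -> T} => \sum_i h i (f i)) = 0.
  rewrite average_sum big1 // => i _.
  by rewrite (average_ffun1 t0 i (h i)).
(* The deviation is the centred sum of the [h i] plus the constant [b], and the cross term averages
   to 0. *)
have -> : average (fun f : {ffun I -> T} => (\sum_i g i (f i) - \sum_i x i) ^+ 2)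
    = \sum_i average (fun t => h i t ^+ 2) + b ^+ 2.
  rewrite -(average_sqr_centered_sum t0 h0).
  transitivity (average (fun f : {ffun I -> T} =>
     (\sum_i h i (f i)) ^+ 2 + (2 * b * (\sum_i h i (f i)) + b ^+ 2))).
    apply: eq_average => f; rewrite /b.
    have -> : \sum_i g i (f i) - \sum_i x i =
        \sum_i h i (f i) + \sum_i (average (g i) - x i).
      rewrite -sumrB -big_split /=; apply: eq_bigr => i _; rewrite /h; ring.
    ring.
  rewrite averageD averageD averageZ sum_h0 mulr0 add0r.
  by rewrite (average_cst [ffun=> t0]).
rewrite lerD2r; apply: ler_sum => i _.
by rewrite (average_sqr_centered t0) gerBl sqr_ge0.
Qed.

End Average.

(** * Protocols driven by a finite public coin *)

(* The coins of all the clients are part of the public randomness, so the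
   private randomness can be trivial. *)
Lemma public_coin_protocol {R : realType} {n d : nat} {T : finType} (t0 : T)
    (enc : 'I_n -> T -> 'rV[R]_d -> seq bool)
    (dec : T -> ('I_n -> seq bool) -> 'rV[R]_d) :
  (forall i t, prefix_free [set s | exists x, enc i t x = s]) ->
  exists pi : protocol R n d, forall X : 'I_n -> 'rV[R]_d,
    cost pi X = (average (fun t => \sum_i (size (enc i t (X i)))%:R))%:E /\
    error pi X = (average (fun t =>
      l2norm (dec t (fun i => enc i t (X i)) - mean X) ^+ 2))%:E.
Proof.
move=> pf.
(* The indices below [#|T|] list [T] once each, so [coin] is uniform; the default [t0] is reached
   only outside the support. *)
pose coin := nth t0 (enum T).
have cardT : #|T|.-1.+1 = #|T| by apply/prednK/card_gt0P; exists t0.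
have expectationE (f : T -> R) : (forall t, 0 <= f t) ->
    expectation (uniform_nat #|T|.-1 : probability nat R) (fun k => f (coin k)) =
    (average f)%:E.
  move=> f0; rewrite expectation_uniform_nat // cardT; congr (_ * _)%:E.
  by rewrite -[RHS]big_enum (big_nth t0) -cardE big_mkord.
pose public_coin : {mfun nat >-> nat} :=
  HB.pack (@id nat) (isMeasurableFun.Build _ _ nat nat id (@measurable_id _ nat setT)).
have indep : mutually_independent (P := (uniform_nat #|T|.-1 : probability nat R))
    public_coin (fun _ : 'I_n => cst tt : {mfun nat >-> unit}).
  move=> A B _ _.
  (* The private variables are constant: either all events [B i] are sure and both sides equal the
     probability of [A], or some [B i] is null and both sides vanish. *)
  have [Btt|/existsNP[i Bi]] := pselect (forall i, B i tt).
    rewrite (_ : [set w | _] = A); last first.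
      by apply/seteqP; split=> [w []|w Aw] //; split.
    rewrite big1 ?mule1 // => i _.
    rewrite (_ : _ @^-1` _ = setT) ?probability_setT //.
    by apply/seteqP; split=> // w _; exact: Btt.
  rewrite (_ : [set w | _] = set0); last first.
    by apply/seteqP; split=> [w [_ /(_ i)]|w] //.
  rewrite measure0 (bigD1 i) //= (_ : cst tt @^-1` B i = set0).
    by rewrite measure0 mul0e mule0.
  by apply/seteqP; split.
pose ec (i : 'I_n) (u : nat) (_ : unit) x := enc i (coin u) x.
pose dc (u : nat) m := dec (coin u) m.
have ec_meas i x s : measurable [set p : nat * unit | ec i p.1 p.2 x = s].
  rewrite (_ : [set p | _] = (fst @^-1` [set k | enc i (coin k) x = s])) //.
  by rewrite -[X in measurable X]setTI; apply: measurable_fst.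
have dc_meas m j : measurable_fun setT (fun u => dc u m 0 j) by [].
have ec_pf i u : prefix_free [set s | exists (v : unit) x, ec i u v x = s].
  by move=> s t [? [x <-]] [? [y <-]]; apply: pf; [exists x|exists y].
exists (Protocol indep ec_meas dc_meas ec_pf) => X; split.
  have := expectationE (fun t => \sum_i (size (enc i t (X i)))%:R).
  by apply=> t; exact: sumr_ge0.
have := expectationE (fun t =>
  l2norm (dec t (fun i => enc i t (X i)) - mean X) ^+ 2).
by apply=> t; exact: sqr_ge0.
Qed.

(** * A prefix-free code for integer sequences of fixed length *)

Definition encode_int (k : int) : seq bool :=
  (k < 0) :: rcons (nseq `|k|%N true) false.

Definition encode_ints (s : seq int) : seq bool := flatten (map encode_int s).

(** After the sign bit, the first [false] stands at index [a], the absolute value. One codeword thus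
    takes [a.+2] bits: sign, unary part and terminator. *)
Fixpoint decode_ints (m : nat) (s : seq bool) : seq int :=
  if m is m'.+1 then
    let a := find negb (behead s) in
    (if head false s then - a%:Z else a%:Z) :: decode_ints m' (drop a.+2 s)
  else [::].

(** The arbitrary tail [r] says that decoding never looks past the code, which is what
    prefix-freeness needs. *)
Lemma encode_intsK (s : seq int) (r : seq bool) :
  decode_ints (size s) (encode_ints s ++ r) = s.
Proof.
elim: s => [//|k s IHs].
have -> : encode_ints (k :: s) ++ r =
    (k < 0) :: nseq `|k|%N true ++ false :: (encode_ints s ++ r).
  by rewrite /encode_ints /= -catA cat_rcons.
have findE t : find negb (nseq `|k|%N true ++ false :: t) = `|k|%N.
  by rewrite find_cat has_nseq andbF /= size_nseq addn0.
rewrite /= findE; congr (_ :: _); first by case: ifP => ?; lia.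
rewrite -cat_rcons drop_size_cat ?IHs //.
by rewrite size_rcons size_nseq.
Qed.

Lemma size_encode_ints (s : seq int) :
  size (encode_ints s) = (\sum_(k <- s) (`|k| + 2))%N.
Proof.
rewrite size_flatten sumnE big_map big_map; apply: eq_bigr => k _.
by rewrite /= size_rcons size_nseq addn2.
Qed.

Lemma encode_ints_prefix_free (m : nat) :
  prefix_free [set encode_ints s | s in [set s | size s = m]].
Proof.
move=> _ _ [s ss <-] [t st <-] /prefixP[r tE].
have tK : decode_ints m (encode_ints t) = t.
  by rewrite -st -[encode_ints t]cats0 encode_intsK.
by rewrite -tK tE -ss encode_intsK.
Qed.

(** * Dithered rounding: bias, second moment and code length *)

Section Quantizer.
Context {R : realType}.

(* Dithered rounding of [t]: the upper neighbour is chosen for a fraction of the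
   [N] values of [v] equal to the fractional part of [t], up to [1 / N]. *)
Definition dither (N : nat) (t : R) (v : 'I_N) : int :=
  Num.floor t + (v < Num.truncn (N%:R * (t - (Num.floor t)%:~R)))%N.

Lemma dither_dist (N : nat) (t : R) (v : 'I_N) :
  `|(dither t v)%:~R - t| <= 1.
Proof.
rewrite /dither rmorphD /=; have /andP[] := floor_itv t.
rewrite intrD ler_norml /=; case: (_ < _)%N => /=; lra.
Qed.

Lemma average_dither_dist (N : nat) (t : R) : (0 < N)%N ->
  `|average (fun v : 'I_N => (dither t v)%:~R) - t| <= N%:R^-1.
Proof.
move=> N0; have N0R : 0 < N%:R :> R by rewrite ltr0n.
pose r := t - (Num.floor t)%:~R; pose m := Num.truncn (N%:R * r).
have /andP[r0 r1] : 0 <= r < 1.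
  by have := floor_itv t; rewrite intrD /r => /andP[? ?]; apply/andP; split; lra.
have Nr0 : 0 <= N%:R * r by rewrite mulr_ge0.
have /andP[m1 m2] := truncn_itv Nr0; rewrite -/m in m1 m2.
(* As [m] is at most [N], exactly [m] values of [v] round up, and the average is the floor plus
   [m / N], within [1 / N] of [t]. *)
have mN : (m <= N)%N.
  by rewrite -(ler_nat R) (le_trans m1) // ler_piMr // ltW.
have sum_lt : \sum_(v < N) (v < m)%N%:R = m%:R :> R.
  under eq_bigr do rewrite mulrb.
  rewrite -big_mkcond -(big_ord_widen N (fun=> 1)) //.
  by rewrite sumr_const card_ord.
have -> : average (fun v : 'I_N => (dither t v)%:~R : R) =
    (Num.floor t)%:~R + N%:R^-1 * m%:R.
  rewrite -sum_lt; set A := RHS.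
  transitivity (average (fun v : 'I_N => (Num.floor t)%:~R + (v < m)%N%:R : R)).
    by apply: eq_average => v; rewrite /dither intrD.
  rewrite averageD (average_cst (Ordinal N0)) /A; congr (_ + _).
  by rewrite /average card_ord.
have -> : (Num.floor t)%:~R + N%:R^-1 * m%:R - t = - (N%:R^-1 * (N%:R * r - m%:R)).
  by rewrite mulrBr mulKf ?gt_eqF // /r; ring.
rewrite normrN normrM [`|_^-1|]ger0_norm ?invr_ge0 // ler_piMr ?invr_ge0 //.
rewrite ger0_norm ?subr_ge0 //; move: m2; rewrite -natr1; lra.
Qed.

Lemma sqr_dither_le (N : nat) (t : R) (v : 'I_N) :
  (dither t v)%:~R ^+ 2 <= 2 * t ^+ 2 + 2 :> R.
Proof.
have := dither_dist t v; set k := _%:~R; rewrite ler_norml => /andP[? ?].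
(* With [k] the rounded value, [2 t^2 + 2 - k^2 = 2 (1 - (k - t)^2) + (k - 2 t)^2]. *)
have : 0 <= (1 + (k - t)) * (1 - (k - t)) by rewrite mulr_ge0 //; lra.
have := sqr_ge0 (k - 2 * t); lra.
Qed.

(** From [|k| <= |t| + 1] and [2 |t| <= t^2 + 1]. A quadratic bound on the unary length lets the sum
    over coordinates be controlled by the Euclidean norm. *)
Lemma absz_dither_le (N : nat) (t : R) (v : 'I_N) :
  `|dither t v|%N%:R <= (t ^+ 2 + 3) / 2 :> R.
Proof.
have := dither_dist t v; rewrite natr_absz intr_norm.
set k := _%:~R => kt.
have k_le : `|k| <= `|t| + 1.
  by rewrite -lerBlDl (le_trans (lerB_dist _ _)).
have := sqr_ge0 (`|t| - 1); have := real_normK (num_real t); nra.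
Qed.

End Quantizer.

(** * The sampling protocol: cost, bias and mean squared error *)

Lemma l2norm_sqr {R : realType} {d : nat} (x : 'rV[R]_d) :
  l2norm x ^+ 2 = \sum_j x 0 j ^+ 2.
Proof. by rewrite sqr_sqrtr // sumr_ge0 // => j _; exact: sqr_ge0. Qed.

Lemma unit_ball_sum_sqr {R : realType} {d : nat} (x : 'rV[R]_d) :
  unit_ball R d x -> \sum_j x 0 j ^+ 2 <= 1.
Proof. by move=> x1; rewrite -l2norm_sqr exprn_ile1 // sqrtr_ge0. Qed.

Section SampledQuantization.
Context {R : realType} {n d q : nat}.
Hypothesis n_gt0 : (0 < n)%N.
Hypothesis d_gt0 : (0 < d)%N.

(** A client speaks when its first coin is 0, so with probability [1 / q.+1]; the second coin is its
    dither, common to all its coordinates. Taking [n] dither values makes each rounding bias at most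
    [1 / n]. *)
Notation coins := ('I_q.+1 * 'I_n)%type.
Let s : R := Num.sqrt d%:R.

Definition quantize (x : 'rV[R]_d) (v : 'I_n) : seq int :=
  [seq dither (Num.sqrt d%:R * x 0 j) v | j <- enum 'I_d].

Definition sampled_message (i : 'I_n) (t : {ffun 'I_n -> coins})
    (x : 'rV[R]_d) : seq bool :=
  if (t i).1 == 0 then encode_ints (quantize x (t i).2) else [::].

(** The public coins tell the server who spoke, and the factor [q.+1] compensates for the sampling
    probability. *)
Definition sampled_estimate (t : {ffun 'I_n -> coins})
    (m : 'I_n -> seq bool) : 'rV[R]_d :=
  n%:R^-1 *: \sum_i if (t i).1 == 0 then
    \row_j (q.+1%:R / Num.sqrt d%:R * (nth 0 (decode_ints d (m i)) j)%:~R)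
  else 0.

(** The contribution of one client to one coordinate, before division by [n], split into a factor
    for each coin so that [average_pair] applies. *)
Definition sampled_coord (y : R) (p : coins) : R :=
  (q.+1%:R * (p.1 == 0)%:R) * (s^-1 * (dither (s * y) p.2)%:~R).

Let coins0 : coins := (ord0, Ordinal n_gt0).

Lemma sampled_message_prefix_free i t :
  prefix_free [set m | exists x, sampled_message i t x = m].
Proof.
move=> _ _ [x <-] [y <-]; rewrite /sampled_message; case: ifP => // _.
by apply: (@encode_ints_prefix_free d);
  [exists (quantize x (t i).2)|exists (quantize y (t i).2)];
  rewrite //= size_map size_enum_ord.
Qed.

Lemma average_indicator0 :
  average (fun r : 'I_q.+1 => (r == 0)%:R) = q.+1%:R^-1 :> R.
Proof.
rewrite /average card_ord (bigD1 0) //= big1 ?addr0 ?mulr1 //.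
by move=> r /negPf ->.
Qed.

Lemma sqr_sqrt_dim : s ^+ 2 = d%:R.
Proof. by rewrite sqr_sqrtr. Qed.

Lemma sqrt_dim_gt0 : 0 < s.
Proof. by rewrite sqrtr_gt0 ltr0n. Qed.

Lemma size_sampled_message_le i t x : unit_ball R d x ->
  (size (sampled_message i t x))%:R <= 4 * d%:R * ((t i).1 == 0)%:R :> R.
Proof.
move=> x1; rewrite /sampled_message.
case: ifP => _; last by rewrite mulr0.
rewrite mulr1 size_encode_ints big_map big_enum /= natr_sum.
(* Since [s^2 = d], each codeword has length at most [(d x_j^2 + 3) / 2 + 2]; summed over the unit
   ball this is at most [d / 2 + 7 d / 2 = 4 d]. *)
have /ler_sum/le_trans : forall j : 'I_d, true ->
    (`|dither (s * x 0 j)%R (t i).2| + 2)%N%:R <= d%:R / 2 * x 0 j ^+ 2 + 7 / 2 :> R.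
  move=> j _; have := absz_dither_le (s * x 0 j) (t i).2.
  rewrite exprMn sqr_sqrt_dim natrD; lra.
apply; rewrite big_split /= -mulr_sumr sumr_const card_ord -mulr_natl.
have := unit_ball_sum_sqr x1; have : 0 <= d%:R :> R by []. 
set S := \sum_j _; nra.
Qed.

Lemma average_sampled_cost_le (X : 'I_n -> 'rV[R]_d) :
  (forall i, unit_ball R d (X i)) ->
  average (fun t => \sum_i (size (sampled_message i t (X i)))%:R) <=
  4 * n%:R * d%:R / q.+1%:R :> R.
Proof.
move=> X1; rewrite average_sum.
have le_i i : average (fun t : {ffun 'I_n -> coins} =>
    (size (sampled_message i t (X i)))%:R) <= 4 * d%:R / q.+1%:R :> R.
  apply: le_trans (le_average (fun t => size_sampled_message_le i t (X1 i))) _.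
  rewrite averageZ (average_ffun1 coins0 i (fun p : coins => (p.1 == 0)%:R)).
  have := average_pair (fun r : 'I_q.+1 => (r == 0)%:R : R) (fun _ : 'I_n => 1).
  rewrite (average_cst (Ordinal n_gt0)) mulr1 average_indicator0.
  by under eq_average do rewrite mulr1; move=> ->.
apply: le_trans (ler_sum _ (fun i _ => le_i i)) _.
by rewrite sumr_const card_ord -mulr_natl le_eqVlt; apply/orP; left; apply/eqP; ring.
Qed.

Lemma sampled_estimateE t (X : 'I_n -> 'rV[R]_d) j :
  sampled_estimate t (fun i => sampled_message i t (X i)) 0 j =
  n%:R^-1 * \sum_i sampled_coord (X i 0 j) (t i).
Proof.
rewrite !mxE summxE; congr (_ * _); apply: eq_bigr => i _.
rewrite /sampled_coord /sampled_message /=; case: ifP => ti; last first.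
  by rewrite mxE mulr0 mul0r.
rewrite mxE mulr1 -mulrA; congr (_ * (_ * _)).
have size_quantize : size (quantize (X i) (t i).2) = d.
  by rewrite size_map size_enum_ord.
have := encode_intsK (quantize (X i) (t i).2) [::].
rewrite cats0 size_quantize ti => ->.
by rewrite (nth_map j) ?size_enum_ord // nth_ord_enum.
Qed.

(** The squared weight [q.+1 ^ 2] meets the probability [1 / q.+1], leaving [q.+1] times the second
    moment of the rounding divided by [s^2 = d]. *)
Lemma average_sqr_sampled_coord_le (y : R) :
  average (fun p => sampled_coord y p ^+ 2) <=
  q.+1%:R * (2 * y ^+ 2 + 2 / d%:R).
Proof.
pose f (r : 'I_q.+1) : R := q.+1%:R ^+ 2 * (r == 0)%:R.
pose g (v : 'I_n) : R := (s^-1 * (dither (s * y) v)%:~R) ^+ 2.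
have fg p : sampled_coord y p ^+ 2 = f p.1 * g p.2.
  by rewrite /sampled_coord /f /g; case: eqP => _ /=; ring.
rewrite (eq_average fg) average_pair averageZ average_indicator0.
rewrite expr2 mulfK ?pnatr_eq0 // ler_pM2l ?ltr0n //.
rewrite -[leRHS](average_cst (Ordinal n_gt0)); apply: le_average => v.
rewrite /g exprMn exprVn sqr_sqrt_dim.
have := sqr_dither_le (s * y) v; rewrite exprMn sqr_sqrt_dim => H.
rewrite ler_pdivrMl ?ltr0n // (le_trans H) // le_eqVlt; apply/orP; left; apply/eqP.
by field; rewrite pnatr_eq0 -lt0n.
Qed.

(** Each client has bias at most [1 / (s n)], so the [n] clients together have at most [1 / s]. Over
    all [d] coordinates the squared biases then sum to at most 1. *)
Lemma sqr_sampled_bias_le (x : 'I_n -> R) :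
  (\sum_i (average (sampled_coord (x i)) - x i)) ^+ 2 <= d%:R^-1.
Proof.
have n0 : 0 < n%:R :> R by rewrite ltr0n.
have bias i : `|average (sampled_coord (x i)) - x i| <= s^-1 / n%:R.
  have -> : average (sampled_coord (x i)) =
      s^-1 * average (fun v : 'I_n => (dither (s * x i) v)%:~R).
    have -> : average (sampled_coord (x i)) = _ := average_pair
      (fun r : 'I_q.+1 => q.+1%:R * (r == 0)%:R)
      (fun v => s^-1 * (dither (s * x i) v)%:~R).
    by rewrite !averageZ average_indicator0 mulfV ?pnatr_eq0 // mul1r.
  rewrite -[X in _ - X](mulKf (lt0r_neq0 sqrt_dim_gt0)) -mulrBr normrM.
  rewrite ger0_norm ?invr_ge0 ?sqrtr_ge0 // ler_pM2l ?invr_gt0 ?sqrt_dim_gt0 //.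
  exact: average_dither_dist.
have : `|\sum_i (average (sampled_coord (x i)) - x i)| <= s^-1.
  apply: le_trans (ler_norm_sum _ _ _) _.
  apply: le_trans (ler_sum _ (fun i _ => bias i)) _.
  by rewrite sumr_const card_ord -[_ *+ n]mulr_natr divfK // gt_eqF.
rewrite -sqr_sqrt_dim -exprVn => le_s.
by rewrite -real_normK ?num_real // lerXn2r ?nnegrE ?invr_ge0 ?sqrtr_ge0.
Qed.

Lemma average_sampled_error_le (X : 'I_n -> 'rV[R]_d) :
  (forall i, unit_ball R d (X i)) ->
  average (fun t => l2norm
    (sampled_estimate t (fun i => sampled_message i t (X i)) - mean X) ^+ 2) <=
  5 * q.+1%:R / n%:R :> R.
Proof.
move=> X1; have n0 : 0 < n%:R :> R by rewrite ltr0n.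
have n1 : 1 <= n%:R :> R by rewrite ler1n.
pose D j (t : {ffun 'I_n -> coins}) : R :=
  (\sum_i sampled_coord (X i 0 j) (t i) - \sum_i X i 0 j) ^+ 2.
have errE t : l2norm
    (sampled_estimate t (fun i => sampled_message i t (X i)) - mean X) ^+ 2 =
    n%:R^-2 * \sum_j D j t.
  rewrite l2norm_sqr mulr_sumr; apply: eq_bigr => j _.
  rewrite mxE sampled_estimateE !mxE summxE -mulrBr exprMn /D exprVn; congr (_ * _).
rewrite (eq_average errE) averageZ average_sum.
have le_j j : average (D j) <=
    \sum_i q.+1%:R * (2 * X i 0 j ^+ 2 + 2 / d%:R) + d%:R^-1.
  apply: (le_trans (average_sqr_sum_le coins0
    (fun i => sampled_coord (X i 0 j)) (fun i => X i 0 j))).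
  apply: lerD.
    by apply: ler_sum => i _; exact: average_sqr_sampled_coord_le.
  exact: sqr_sampled_bias_le.
(* Each client contributes at most [q.+1 * (2 + 2)] over all coordinates; the final 1 is the squared
   bias, later absorbed to turn 4 into 5. *)
have le_sum : \sum_j average (D j) <= 4 * q.+1%:R * n%:R + 1.
  apply: (le_trans (ler_sum _ (fun j _ => le_j j))).
  have d0 : d%:R != 0 :> R by rewrite pnatr_eq0 -lt0n.
  rewrite big_split /= sumr_const card_ord -[d%:R^-1 *+ d]mulr_natr mulVf // lerD2r.
  rewrite exchange_big /=.
  have le_i i : \sum_j q.+1%:R * (2 * X i 0 j ^+ 2 + 2 / d%:R) <= 4 * q.+1%:R.
    rewrite -mulr_sumr big_split /= -mulr_sumr sumr_const card_ord.
    rewrite -[(2 / d%:R) *+ d]mulr_natr divfK // mulrC ler_pM2r ?ltr0n //.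
    have := unit_ball_sum_sqr (X1 i); set S := \sum_j _; lra.
  apply: (le_trans (ler_sum _ (fun i _ => le_i i))).
  by rewrite sumr_const card_ord -[_ *+ n]mulr_natr.
have -> : 5 * q.+1%:R / n%:R = n%:R^-2 * (5 * q.+1%:R * n%:R) :> R.
  by field; rewrite gt_eqF.
rewrite ler_pM2l ?invr_gt0 ?exprn_gt0 //.
apply: le_trans le_sum _.
have : 1 <= q.+1%:R :> R by rewrite ler1n.
nra.
Qed.

End SampledQuantization.

(** * The silent protocol and the choice of the sampling rate *)

Lemma l2norm_mean_le {R : realType} {n d : nat} (X : 'I_n -> 'rV[R]_d) :
  (0 < n)%N -> (forall i, unit_ball R d (X i)) -> l2norm (- mean X) ^+ 2 <= 1.
Proof.
move=> n0 X1; rewrite l2norm_sqr.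
(* Convexity of the square, coordinate by coordinate. *)
have le_j j : (- mean X) 0 j ^+ 2 <= average (fun i => X i 0 j ^+ 2).
  apply: le_trans (sqr_average_le (Ordinal n0) _).
  by rewrite !mxE sqrrN summxE /average card_ord.
apply: le_trans (ler_sum _ (fun j _ => le_j j)) _.
rewrite -average_sum -[leRHS](average_cst (Ordinal n0)).
by apply: le_average => i; exact: unit_ball_sum_sqr.
Qed.

Lemma silent_protocol {R : realType} {n d : nat} : (0 < n)%N ->
  exists pi : protocol R n d,
    (worst_cost pi (unit_ball R d) <= 0)%E /\
    (worst_error pi (unit_ball R d) <= 1)%E.
Proof.
move=> n0.
have [|pi piE] := public_coin_protocol tt
  (enc := fun (_ : 'I_n) _ _ => [::]) (fun _ _ => 0 : 'rV[R]_d).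
  by move=> _ _ _ _ [? <-] [? <-].
exists pi; split; apply: ge_ereal_sup => _ [X X1 <-].
  rewrite (proj1 (piE X)) lee_fin; under eq_average do rewrite big1 //.
  by rewrite average_cst.
rewrite (proj2 (piE X)) lee_fin (average_cst tt) sub0r.
exact: l2norm_mean_le.
Qed.

Lemma sampling_protocol {R : realType} {n d : nat} (q : nat) :
  (0 < n)%N -> (0 < d)%N ->
  exists pi : protocol R n d,
    (worst_cost pi (unit_ball R d) <= (4 * n%:R * d%:R / q.+1%:R)%:E)%E /\
    (worst_error pi (unit_ball R d) <= (5 * q.+1%:R / n%:R)%:E)%E.
Proof.
move=> n0 d0; have [pi piE] := public_coin_protocol
  ([ffun=> (ord0, Ordinal n0)] : {ffun 'I_n -> 'I_q.+1 * 'I_n})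
  (@sampled_estimate R n d q) (@sampled_message_prefix_free R n d q).
exists pi; split; apply: ge_ereal_sup => _ [X X1 <-].
  by rewrite (proj1 (piE X)) lee_fin average_sampled_cost_le.
by rewrite (proj2 (piE X)) lee_fin average_sampled_error_le.
Qed.

Lemma log2_le1 {R : realType} (x : R) : 0 < x -> x <= 2 -> log2 x <= 1.
Proof.
move=> x0 x2; rewrite /log2 ler_pdivrMr ?mul1r ?ln_gt0 ?ltr1n //.
by rewrite ler_ln ?posrE.
Qed.

Theorem corollary1 (R : realType) :
  exists C : R, forall (n d : nat) (c : R),
    (1 <= n)%N -> (1 <= d)%N ->
    0 < c -> c <= n%:R * d%:R * (2 + log2 (7 / 4)) ->
    exists pi : protocol R n d,
      (worst_cost pi (unit_ball R d) <= c%:E)%E /\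
      (worst_error pi (unit_ball R d) <= (C * Num.min 1 (d%:R / c))%:E)%E.
Proof.
(* Here 35 is 5 times 7: the 5 is the error constant of [sampling_protocol], the 7 comes from
   [q1_le]. *)
exists 35 => n d c n0 d0 c0 c_le.
have nR : 0 < n%:R :> R by rewrite ltr0n.
have dR : 0 < d%:R :> R by rewrite ltr0n.
have {}c_le : c <= 3 * (n%:R * d%:R).
  apply: le_trans c_le _; rewrite [leRHS]mulrC ler_pM2l ?mulr_gt0 //.
  have : log2 (7 / 4 : R) <= 1 by apply: log2_le1; lra.
  lra.
have [cd|dc] := lerP c d%:R.
  have [pi [cost_pi error_pi]] := @silent_protocol R n d n0.
  exists pi; split; first by rewrite (le_trans cost_pi) // lee_fin ltW.
  apply: le_trans error_pi _; rewrite lee_fin min_l ?mulr1 ?ler1n //.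
  by rewrite ler_pdivlMr // mul1r.
have nd0 : 0 < n%:R * d%:R :> R by rewrite mulr_gt0.
(* The sampling probability is [1 / q.+1]; as [q.+1] exceeds [4 n d / c], the cost is at most
   [c]. *)
pose q := Num.truncn (4 * (n%:R * d%:R) / c).
have /andP[q_le q_gt] := truncn_itv (ltW (divr_gt0 (mulr_gt0 (ltr0n _ 4) nd0) c0)).
rewrite -/q in q_le q_gt.
have [pi [cost_pi error_pi]] := @sampling_protocol R n d q n0 d0.
exists pi; split.
  apply: le_trans cost_pi _; rewrite lee_fin ler_pdivrMr ?ltr0n // -mulrA.
  by rewrite [c * _]mulrC -ler_pdivrMr // ltW.
apply: le_trans error_pi _; rewrite lee_fin min_r; last first.
  by rewrite ler_pdivrMr // mul1r ltW.
(* The upper bound on [c] enters here: [c <= 3 n d] bounds the rounding term 1 by [3 n d / c], and 4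
   + 3 = 7. *)
have q1_le : q.+1%:R <= 7 * (n%:R * d%:R) / c.
  rewrite -natr1; apply: (le_trans (lerD q_le (lexx 1))).
  by rewrite ler_pdivlMr // mulrDl divfK ?gt_eqF // mul1r; lra.
rewrite ler_pdivrMr //.
apply: le_trans (_ : 5 * (7 * (n%:R * d%:R) / c) <= _); first by rewrite ler_pM2l.
by rewrite le_eqVlt; apply/orP; left; apply/eqP; field; rewrite gt_eqF.
Qed.
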